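(* Let $G$ be a connected graph of order $n\geq 2$ which has a Hamiltonian path. Then $$\gamma_{tm}(G)\leq \begin{cases}\lfloor 2n/3\rfloor & \text{if } n\equiv 0 \pmod 3,\\ \lfloor 2n/3\rfloor+1 & \text{if } n\equiv 1,2 \pmod 3.\end{cases}$$
   Context: All graphs are non-empty, finite, undirected and simple. A Hamiltonian path in $G$ is a path containing every vertex of $G$. A total mixed dominating set of a graph $G=(V,E)$ with minimum degree at least $1$ is a set $S\subseteq V\cup E$ such that every element of $V\cup E$ (including those in $S$) is adjacent or incident to an element of $S$ (two vertices are adjacent if joined by an edge; two distinct edges are adjacent if they share an endpoint; a vertex and an edge are incident if the vertex is an endpoint of the edge; no element is adjacent or incident to itself). The total mixed domination number $\gamma_{tm}(G)$ is the minimum cardinality of a total mixed dominating set. *)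

(* Defs.v *)
From mathcomp Require Import all_boot.

Set Implicit Arguments.
Unset Strict Implicit.
Unset Printing Implicit Defensive.

Record sgraph := SGraph {
  vertex :> finType;
  adj : rel vertex;
  adj_sym : symmetric adj;
  adj_irr : irreflexive adj
}.

Definition connected (G : sgraph) : Prop :=
  0 < #|G| /\ forall x y : G, connect (@adj G) x y.

Definition degree (G : sgraph) (x : G) : nat := #|[set y | adj x y]|.

Definition hamiltonian_path (G : sgraph) (s : seq G) : bool :=
  [&& sorted (@adj G) s, uniq s & [forall x : G, x \in s]].

Definition has_hamiltonian_path (G : sgraph) : Prop :=
  exists s : seq G, hamiltonian_path s.

Definition is_edge (G : sgraph) (A : {set G}) : bool :=
  [exists x : G, exists y : G, adj x y && (A == [set x; y])].

Definition edge (G : sgraph) := {A : {set G} | is_edge A}.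

(* The disjoint union of V and E. *)
Definition element (G : sgraph) := (G + edge G)%type.

Definition adj_or_inc (G : sgraph) (a b : element G) : bool :=
  match a, b with
  | inl x, inl y => adj x y
  | inl x, inr f => x \in val f
  | inr f, inl x => x \in val f
  | inr f, inr g => (f != g) && (val f :&: val g != set0)
  end.

Definition total_mixed_dominating (G : sgraph) (S : {set element G}) : bool :=
  [forall a : element G, exists b in S, adj_or_inc a b].

(* The argument [set: element G] of arg min is its default value; it is itself
   total mixed dominating when the minimum degree is at least 1, see
   gamma_tmP. *)
Definition gamma_tm (G : sgraph) : nat :=
  #|[arg min_(S < [set: element G] | total_mixed_dominating S) #|S|]|.

Lemma total_mixed_dominatingT (G : sgraph) :
  (forall x : G, 1 <= degree x) ->
  total_mixed_dominating [set: element G].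
Proof.
move=> hd; apply/forallP => -[x|[A hA]].
  have /card_gt0P [y] := hd x; rewrite inE => xy.
  by apply/existsP; exists (inl y); rewrite inE.
have /existsP [x /existsP [y /andP [xy /eqP eA]]] := hA.
by apply/existsP; exists (inl x); rewrite !inE /= eA !inE eqxx.
Qed.

Lemma gamma_tmP (G : sgraph) :
  (forall x : G, 1 <= degree x) ->
  (exists2 S : {set element G}, total_mixed_dominating S & #|S| = gamma_tm G) /\
  (forall S : {set element G}, total_mixed_dominating S -> gamma_tm G <= #|S|).
Proof.
move=> hd; rewrite /gamma_tm.
case: arg_minnP => [|S hS minS]; first exact: total_mixed_dominatingT.
by split; [exists S | exact: minS].
Qed.

(* Main.v *)
Require Import Defs.
From mathcomp Require Import all_boot.
From mathcomp Require Import zify.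

(** The dominating sets built here touch every vertex by one of their edges.
Such a set dominates all vertices, and it dominates every edge [f] outside it,
because an end of [f] is touched by a member edge, necessarily different from
[f]. So the only thing left to arrange is that each member edge has a member
next to it ([edge_cover], [edge_cover_dominating]).

Edge covers of different parts of the vertex set can be united, with no care
about edges of [G] between the parts ([edge_cover_cat]). Hence one may cut the
Hamiltonian path into blocks of three consecutive vertices and take the two
path edges of each block, at a cost of 2 elements for 3 vertices
([edge_cover3]). When the order is 1 modulo 3, one block has four vertices and
costs 3 ([edge_cover_pendant]); when it is 2 modulo 3, there is a block of two
vertices, which costs 2 ([edge_cover2]). In all cases a path on [n] vertices
costs at most [(2 * n + n %% 3) / 3], which is the claimed bound. *)

(** The second conjunct lets the neighbour of a member edge be a vertex: on a
path with two vertices there is no second edge available. *)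
Definition edge_cover (G : sgraph) (s : seq G) (S : {set element G}) : Prop :=
  (forall x, x \in s -> exists2 f : edge G, inr f \in S & x \in val f) /\
  (forall f : edge G, inr f \in S ->
     exists2 b, b \in S & adj_or_inc (inr f) b).

Lemma edge_of_adj (G : sgraph) (x y : G) :
  adj x y -> exists e : edge G, val e = [set x; y].
Proof.
move=> xy; have e_xy : is_edge [set x; y].
  by apply/existsP; exists x; apply/existsP; exists y; rewrite xy eqxx.
by exists (exist (fun A : {set G} => is_edge A) _ e_xy).
Qed.

Lemma edges_sharing_end (G : sgraph) (f g : edge G) (x : G) :
  f != g -> x \in val f -> x \in val g -> adj_or_inc (inr f) (inr g).
Proof.
by move=> fg xf xg; rewrite /= fg; apply/set0Pn; exists x; rewrite inE xf.
Qed.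

Lemma edge_cover0 (G : sgraph) : edge_cover G [::] set0.
Proof. by split=> [x | f]; rewrite ?in_nil ?inE. Qed.

Lemma edge_cover_cat (G : sgraph) (s t : seq G) (S T : {set element G}) :
  edge_cover G s S -> edge_cover G t T -> edge_cover G (s ++ t) (S :|: T).
Proof.
move=> [covS adjS] [covT adjT]; split=> [x | f].
  rewrite mem_cat => /orP[/covS | /covT] [f fin xf];
    by exists f; rewrite // inE fin ?orbT.
rewrite inE => /orP[/adjS | /adjT] [b bin fb];
  by exists b; rewrite // inE bin ?orbT.
Qed.

(** The member edge that touches [z] is a neighbour of the new edge [zw],
unless [zw] was a member already. *)
Lemma edge_cover_pendant (G : sgraph) (s : seq G) (S : {set element G})
    (z w : G) :
  edge_cover G s S -> z \in s -> adj z w ->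
  exists2 T : {set element G}, edge_cover G (rcons s w) T & #|T| <= #|S|.+1.
Proof.
move=> [covS adjS] zs /edge_of_adj[e def_e].
exists (inr e |: S); last by rewrite cardsU1; case: (_ \notin _).
split=> [x | f].
  rewrite mem_rcons inE => /orP[/eqP-> | /covS[f fS xf]].
    by exists e; rewrite ?def_e !inE eqxx ?orbT.
  by exists f; rewrite // inE fS orbT.
have inS g : inr g \in S ->
    exists2 b, b \in inr e |: S & adj_or_inc (inr g) b.
  by move=> /adjS[b bS gb]; exists b; rewrite // inE bS orbT.
rewrite in_setU1 => /orP[/eqP[->] | /inS //].
have [g gS zg] := covS z zs.
have [eq_ge | neq_ge] := eqVneq g e; first by apply: inS; rewrite -eq_ge.
exists (inr g); first by rewrite inE gS orbT.
by apply: (@edges_sharing_end G e g z); rewrite 1?eq_sym ?def_e ?inE ?eqxx.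
Qed.

Lemma edge_cover2 (G : sgraph) (x y : G) :
  adj x y ->
  exists2 S : {set element G}, edge_cover G [:: x; y] S & #|S| <= 2.
Proof.
move=> /edge_of_adj[e def_e].
exists [set inl x; inr e]; last by rewrite cards2; case: (_ != _).
split=> [v | f].
  by rewrite !inE => xy_v; exists e; rewrite ?def_e !inE ?eqxx ?orbT.
rewrite !inE => /orP[/eqP // | /eqP[->]].
by exists (inl x); rewrite /= ?def_e !inE eqxx.
Qed.

Lemma edge_cover3 (G : sgraph) (x y z : G) :
  adj x y -> adj y z -> x != z ->
  exists2 S : {set element G}, edge_cover G [:: x; y; z] S & #|S| <= 2.
Proof.
move=> xy /edge_of_adj[f def_f] xz.
have /negPf neq_xy : x != y by apply: contraTneq xy => ->; rewrite adj_irr.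
have [e def_e] := edge_of_adj G x y xy.
have neq_ef : e != f.
  apply: contraNneq xz => ef; have: x \in val f by rewrite -ef def_e !inE eqxx.
  by rewrite def_f !inE neq_xy.
have ye : y \in val e by rewrite def_e !inE eqxx orbT.
have yf : y \in val f by rewrite def_f !inE eqxx.
exists [set inr e; inr f]; last by rewrite cards2; case: (_ != _).
split=> [v | g].
  rewrite !inE => /or3P[] /eqP->; [exists e | exists e | exists f];
    by rewrite ?def_e ?def_f !inE ?eqxx ?orbT.
rewrite !inE => /orP[] /eqP[->].
  exists (inr f); first by rewrite !inE eqxx orbT.
  exact: (edges_sharing_end G e f y).
exists (inr e); first by rewrite !inE eqxx.
by apply: (edges_sharing_end G f e y); rewrite // eq_sym.
Qed.

(** A single vertex has no edge cover, so the induction that removes three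
vertices at a time has the lengths 0, 2 and 4 as base cases. *)
Lemma path_edge_cover (G : sgraph) (s : seq G) :
  sorted (@adj G) s -> uniq s -> size s != 1 ->
  exists2 S : {set element G},
    edge_cover G s S & 3 * #|S| <= 2 * size s + size s %% 3.
Proof.
have [m] := ubnP (size s); elim: m s => // m IHm.
case=> [|x [|y [|z s]]] // le_s_m.
- by move=> _ _ _; exists set0; rewrite ?cards0 //; apply: edge_cover0.
- move=> /andP[xy _] _ _; have [S covS leS] := edge_cover2 G x y xy.
  by exists S; rewrite // [size _]/=; lia.
move=> /and3P[xy yz zs] /and4P[]; rewrite !inE !negb_or.
move=> /and3P[_ xz _] _ _ uniq_s _.
have [S covS leS] := edge_cover3 G x y z xy yz xz.
have [size_s1 | size_s] := eqVneq (size s) 1.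
  case: s size_s1 zs {le_s_m uniq_s} => [|w []] // _ /andP[zw _].
  have zin : z \in [:: x; y; z] by rewrite !inE eqxx !orbT.
  have [T covT leT] := edge_cover_pendant G _ S z w covS zin zw.
  by exists T; [exact: covT | rewrite [size _]/=; lia].
have lt_s_m : size s < m by move: le_s_m => /=; lia.
have [T covT leT] := IHm s lt_s_m (path_sorted zs) uniq_s size_s.
exists (S :|: T); first exact: (edge_cover_cat G [:: x; y; z]).
by have [leU _] := leq_card_setU S T; rewrite [size _]/=; lia.
Qed.

Lemma edge_cover_dominating (G : sgraph) (s : seq G) (S : {set element G}) :
  (forall x, x \in s) -> edge_cover G s S -> total_mixed_dominating S.
Proof.
move=> s_all [covS adjS]; apply/forallP=> -[x | f]; apply/exists_inP.
  by have [f fS xf] := covS x (s_all x); exists (inr f).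
have [/adjS // | fNS] := boolP (inr f \in S).
have /existsP[x /existsP[y /andP[_ /eqP def_f]]] := valP f.
have [g gS xg] := covS x (s_all x); exists (inr g) => //.
apply: (edges_sharing_end G f g x) => //; last by rewrite def_f !inE eqxx.
by apply: contraNneq fNS => ->.
Qed.

(** The default value of the arg min in [gamma_tm] dominates as soon as some
set does, and then the arg min is a true minimum. *)
Lemma gamma_tm_le (G : sgraph) (S : {set element G}) :
  total_mixed_dominating S -> gamma_tm G <= #|S|.
Proof.
move=> domS; rewrite /gamma_tm; case: arg_minnP => [|T _]; last exact.
apply/forallP=> a; have /exists_inP[b _ ab] := forallP domS a.
by apply/exists_inP; exists b; rewrite ?inE.
Qed.

Theorem theorem2p8 (G : sgraph) (n : nat) :
  connected G -> #|G| = n -> 2 <= n -> has_hamiltonian_path G ->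
  gamma_tm G <= (if n %% 3 == 0 then (2 * n) %/ 3 else (2 * n) %/ 3 + 1).
Proof.
move=> _ cardG n_ge2 [s /and3P[path_s uniq_s /forallP s_all]].
have size_s : size s = n.
  by rewrite -cardG -(card_uniqP uniq_s); apply: eq_card => x; rewrite s_all.
have size_neq1 : size s != 1 by lia.
have [S covS leS] := path_edge_cover G s path_s uniq_s size_neq1.
apply: leq_trans (gamma_tm_le G S (edge_cover_dominating G s S s_all covS)) _.
by move: leS; rewrite size_s; case: eqP; lia.
Qed.
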